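(* Let $n\ge1$ and $D\subseteq[n-1]$. Then $$\tilde Q_{n,D}(X,Y)=\sum_{i=0}^{n}F_{i,D_1}(X)\,F_{n-i,D_2}(Y),$$ where for each $i$ the sets $D_1\subseteq[i-1]$ and $D_2\subseteq[n-i-1]$ are the ones determined by: $\boldsymbol{\beta}(D_1)\cdot\boldsymbol{\beta}(\overline{D_2})=\boldsymbol{\beta}(D)$ if $i\in D$, and $\boldsymbol{\beta}(D_1)\odot\boldsymbol{\beta}(\overline{D_2})=\boldsymbol{\beta}(D)$ if $i\notin D$; here $\overline{D_2}=[n-i-1]\setminus D_2$.
   Context: Fix $k,l\ge0$, $\mathcal{A}=\{1,\dots,k\}$, $\mathcal{A}'=\{1',\dots,l'\}$ with total order $1<\dots<k<1'<\dots<l'$, $X=(x_1,\dots,x_k)$, $Y=(y_1,\dots,y_l)$, and set $z_a=x_a$ for $a\in\mathcal{A}$, $z_{a'}=y_a$ for $a'\in\mathcal{A}'$. $[p]=\{1,\dots,p\}$ (empty if $p\le 0$). Fundamental quasisymmetric function: for $D\subseteq[n-1]$ and a totally ordered variable set $W=(w_1,w_2,\dots)$, $F_{n,D}(W)=\sum w_{a_1}\cdots w_{a_n}$ over $a_1\le\dots\le a_n$ with $a_i=a_{i+1}\Rightarrow i\notin D$; $F_{0,\emptyset}=1$. Super fundamental quasisymmetric function: $\tilde Q_{n,D}(X,Y)=\sum z_{a_1}\cdots z_{a_n}$ over sequences $a_1\le a_2\le\dots\le a_n$ in $\mathcal{A}\cup\mathcal{A}'$ such that $a_i=a_{i+1}\in\mathcal{A}\Rightarrow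 i\notin D$ and $a_i=a_{i+1}\in\mathcal{A}'\Rightarrow i\in D$. For $S=\{s_1<\dots<s_p\}\subseteq[N-1]$, $\boldsymbol\beta(S)=(s_1,s_2-s_1,\dots,s_p-s_{p-1},N-s_p)$, a composition of $N$ (with $\boldsymbol\beta(\emptyset)=(N)$ for $N\ge 1$ and the empty composition for $N=0$). Concatenation: $(\alpha_1,\dots,\alpha_p)\cdot(\gamma_1,\dots,\gamma_q)=(\alpha_1,\dots,\alpha_p,\gamma_1,\dots,\gamma_q)$; almost concatenation: $(\alpha_1,\dots,\alpha_p)\odot(\gamma_1,\dots,\gamma_q)=(\alpha_1,\dots,\alpha_{p-1},\alpha_p+\gamma_1,\gamma_2,\dots,\gamma_q)$, with the convention that concatenating or almost concatenating with the empty composition leaves the other composition unchanged. *)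

(* Defs.v *)
From HB Require Import structures.
From mathcomp Require Import all_boot all_order all_algebra.
From mathcomp Require Import finmap mpoly.

Set Implicit Arguments.
Unset Strict Implicit.
Unset Printing Implicit Defensive.

Import GRing.Theory.
Local Open Scope ring_scope.

(* [p] = {1, ..., p}.  The sets [N-1] below are written [init_interval N.-1], so that
   N = 0 gives the empty set. *)
Definition init_interval (p : nat) : {fset nat} := [fset i in iota 1 p]%fset.

(* Sequence positions are 1-based in the mathematics and 0-based in 'I_n, and
   two ordinals with j = i.+1 stand for the consecutive positions i.+1 and
   i.+2: the position tested against D is i.+1. *)
Definition F_seq (n m : nat) (D : {fset nat}) (a : {ffun 'I_n -> 'I_m}) : bool :=
  [forall i : 'I_n, forall j : 'I_n, (j == i.+1 :> nat) ==>
     ((a i <= a j)%N && ((a i == a j) ==> (i.+1 \notin D)))].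

Definition fundQ (R : comNzRingType) (m n : nat) (D : {fset nat})
    (w : 'I_m -> R) : R :=
  \sum_(a : {ffun 'I_n -> 'I_m} | F_seq D a) \prod_(i < n) w (a i).

(* The ordered alphabet 1 < ... < k < 1' < ... < l' is 'I_(k + l): the letters
   of A are those below k, and the remaining ones are those of A'. *)
Definition superQ_seq (n k l : nat) (D : {fset nat})
    (a : {ffun 'I_n -> 'I_(k + l)}) : bool :=
  [forall i : 'I_n, forall j : 'I_n, (j == i.+1 :> nat) ==>
     [&& (a i <= a j)%N,
         ((a i == a j) && (a i < k)%N) ==> (i.+1 \notin D) &
         ((a i == a j) && (k <= a i)%N) ==> (i.+1 \in D)]].

Definition zvar (R : comNzRingType) (k l : nat) (x : 'I_k -> R) (y : 'I_l -> R)
    (a : 'I_(k + l)) : R :=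
  match split a with inl i => x i | inr j => y j end.

Definition superQ (R : comNzRingType) (k l n : nat) (D : {fset nat})
    (x : 'I_k -> R) (y : 'I_l -> R) : R :=
  \sum_(a : {ffun 'I_n -> 'I_(k + l)} | superQ_seq D a)
     \prod_(i < n) zvar x y (a i).

Definition Xvar (R : comNzRingType) (k l : nat) (i : 'I_k) : {mpoly R[k + l]} :=
  'X_(lshift l i).
Definition Yvar (R : comNzRingType) (k l : nat) (j : 'I_l) : {mpoly R[k + l]} :=
  'X_(rshift k j).

(* The successive differences of 0 < s_1 < ... < s_p < N. *)
Definition beta (N : nat) (S : {fset nat}) : seq nat :=
  if N is 0 then [::]
  else pairmap (fun s t => (t - s)%N) 0%N (rcons (sort leq S) N).

Definition almost_cat (a c : seq nat) : seq nat :=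
  match a, c with
  | [::], _ => c
  | _, [::] => a
  | x :: a', y :: c' => belast x a' ++ (last x a' + y)%N :: c'
  end.

Definition determined (n : nat) (D : {fset nat}) (i : nat)
    (D1 D2 : {fset nat}) : Prop :=
  let b1 := beta i D1 in
  let b2 := beta (n - i) (init_interval (n - i).-1 `\` D2)%fset in
  [/\ (D1 `<=` init_interval i.-1)%fset,
      (D2 `<=` init_interval (n - i).-1)%fset &
      (if i \in D then b1 ++ b2 else almost_cat b1 b2) = beta n D].

(* Main.v *)
(** A weakly increasing word over the ordered alphabet [A < A'] is a word over
    [A] followed by a word over [A'].  Splitting words according to the length
    [i] of the first part gives the sum.  The positions of [D] below [i]
    constrain the first part as [D_1] does, those above [i] constrain the second
    part as the complement of [D_2] does, and position [i] itself imposes nothing.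
    For compositions, gluing [beta(D_1)] and [beta(E)] yields [beta] of
    the union of [D_1], of [i + E], and of [{i}] when concatenating; as [beta] is
    injective, this identifies [D_1] and [D_2]. *)
Require Import Defs.
From HB Require Import structures.
From mathcomp Require Import all_boot all_order all_algebra.
From mathcomp Require Import finmap mpoly zify.

Set Implicit Arguments.
Unset Strict Implicit.
Unset Printing Implicit Defensive.

Import GRing.Theory.
Local Open Scope ring_scope.

(** * Successive differences of sequences of natural numbers *)

Local Notation diffs := (pairmap (fun s t => (t - s)%N)).

(** Subtraction is truncated, so a difference determines the next entry only along a weakly
    increasing sequence; hence the [path] hypotheses. *)
Lemma diffs_inj (s t : seq nat) x :
  path leq x s -> path leq x t -> diffs x s = diffs x t -> s = t.
Proof.
elim: s t x => [|a s IH] [|b t] x //= /andP[xa sa] /andP[xb tb] [e1 e2].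
have eab : a = b by lia.
by rewrite -eab in tb e2 *; rewrite (IH _ _ sa tb e2).
Qed.

Lemma diffs_shift i (s : seq nat) x :
  diffs (i + x)%N (map (addn i) s) = diffs x s.
Proof. by elim: s x => //= a s IH x; rewrite IH subnDl. Qed.

Lemma almost_cat_rcons (a c : seq nat) u v :
  almost_cat (rcons a u) (v :: c) = a ++ (u + v)%N :: c.
Proof.
by case: a => [|x a] //=; rewrite belast_rcons last_rcons.
Qed.

(** If [i] is kept, the differences break there, and those of the shifted tail based at [i] are
    those of [t] based at 0. If [i] is dropped, the two differences meeting at [i] add up, which is
    almost concatenation. *)
Lemma diffs_glue b (s t : seq nat) i m : path leq 0%N (rcons s i) ->
  (if b then diffs 0%N (rcons s i) ++ diffs 0%N (rcons t m)
   else almost_cat (diffs 0%N (rcons s i)) (diffs 0%N (rcons t m))) =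
  diffs 0%N (rcons (s ++ nseq b i ++ map (addn i) t) (i + m)%N).
Proof.
move=> ps; case: b => /=.
  rewrite rcons_cat rcons_cons -map_rcons -cat_rcons pairmap_cat.
  by rewrite last_rcons -{3}(addn0 i) diffs_shift.
rewrite rcons_cat -map_rcons pairmap_cat -!cats1 pairmap_cat /= cats1.
case e: (t ++ [:: m]) => [|h t'] /=; first by case: (t) e.
rewrite almost_cat_rcons diffs_shift; congr (_ ++ _ :: _).
(* The last entry before [i] is at most [i], so the two truncated differences add up exactly. *)
move: ps; rewrite rcons_path => /andP[_]; lia.
Qed.

(** * Subsets of [N-1], their compositions, and gluing *)

Lemma in_init_interval p x : (x \in init_interval p) = (0 < x <= p)%N.
Proof. by rewrite /init_interval !inE mem_iota add1n ltnS. Qed.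

Lemma sub_init_interval (S : {fset nat}) p x :
  (S `<=` init_interval p)%fset -> x \in S -> (0 < x <= p)%N.
Proof. by move=> /fsubsetP h /h; rewrite in_init_interval. Qed.

Lemma sorted_sort_fset (S : {fset nat}) : sorted ltn (sort leq S).
Proof.
by rewrite ltn_sorted_uniq_leq sort_uniq fset_uniq sort_sorted //; exact: leq_total.
Qed.

Lemma sort_fset_eq (S : {fset nat}) (s : seq nat) :
  sorted ltn s -> s =i S -> sort leq S = s.
Proof.
move=> ss sS; apply: (irr_sorted_eq ltn_trans ltnn (sorted_sort_fset S) ss).
by move=> x; rewrite mem_sort sS.
Qed.

Lemma path_sort_rcons (S : {fset nat}) N : (S `<=` init_interval N.-1)%fset ->
  path leq 0%N (rcons (sort leq S) N).
Proof.
move=> sub; rewrite path_min_sorted; last by apply/allP.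
rewrite (sorted_pairwise leq_trans) pairwise_rcons -(sorted_pairwise leq_trans).
rewrite sort_sorted ?andbT; last exact: leq_total.
by apply/allP => x; rewrite mem_sort => /(sub_init_interval sub); lia.
Qed.

Lemma betaE N S : (0 < N)%N -> beta N S = diffs 0%N (rcons (sort leq S) N).
Proof. by case: N. Qed.

Lemma beta_inj N (S T : {fset nat}) : (0 < N)%N ->
  (S `<=` init_interval N.-1)%fset -> (T `<=` init_interval N.-1)%fset ->
  beta N S = beta N T -> S = T.
Proof.
move=> N0 sS sT; rewrite !betaE //.
move=> /(diffs_inj (path_sort_rcons sS) (path_sort_rcons sT)) /rcons_inj [e].
by apply/fsetP => x; rewrite -(mem_sort leq) e mem_sort.
Qed.

Lemma sort_fset0 : sort leq (fset0 : {fset nat}) = [::].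
Proof. by apply: sort_fset_eq => // x; rewrite inE. Qed.

(** The proper partial sums of the concatenation ([b] true) or almost concatenation ([b] false) of
    the compositions encoded by [S] and [E], the first one of size [i]. *)
Definition glue_set (b : bool) i (S E : {fset nat}) : {fset nat} :=
  [fset x in sort leq S ++ nseq b i ++ map (addn i) (sort leq E)]%fset.

(** The guards make the three alternatives exclusive, so comparing [x] with [i] leaves a single
    one. *)
Lemma in_glue_set b i (S E : {fset nat}) m x :
  (S `<=` init_interval i.-1)%fset -> (E `<=` init_interval m.-1)%fset ->
  (x \in glue_set b i S E) =
  [|| (x < i)%N && (x \in S), b && (x == i) | (i < x)%N && ((x - i)%N \in E)].
Proof.
move=> sS sE; rewrite /glue_set !inE mem_sort mem_nseq lt0b.
congr [|| _, _ | _].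
  case xS: (x \in S); rewrite ?andbF ?andbT //.
  by have := sub_init_interval sS xS; lia.
apply/mapP/andP => [[y]|[ix xE]].
  rewrite mem_sort => yE ->; rewrite addKn; split=> //.
  by have := sub_init_interval sE yE; lia.
by exists (x - i)%N; rewrite ?mem_sort // subnKC // ltnW.
Qed.

(** The three blocks lie below, at and above [i], so their concatenation is already strictly
    increasing. *)
Lemma sort_glue_set b i (S E : {fset nat}) m :
  (S `<=` init_interval i.-1)%fset -> (E `<=` init_interval m.-1)%fset ->
  sort leq (glue_set b i S E) =
  sort leq S ++ nseq b i ++ map (addn i) (sort leq E).
Proof.
move=> sS sE; apply: sort_fset_eq => [|x]; last by rewrite in_fset.
have bS : all (ltn^~ i) (sort leq S).
  by apply/allP => x; rewrite mem_sort => /(sub_init_interval sS) /=; lia.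
have bE : all (ltn i) (map (addn i) (sort leq E)).
  apply/allP => _ /mapP[x + ->]; rewrite mem_sort => /(sub_init_interval sE) /=.
  lia.
have pE : pairwise ltn (map (addn i) (sort leq E)).
  rewrite -(sorted_pairwise ltn_trans).
  apply: homo_sorted (sorted_sort_fset E) => x y /=.
  by rewrite ltn_add2l.
rewrite (sorted_pairwise ltn_trans) !pairwise_cat pE.
rewrite -(sorted_pairwise ltn_trans) sorted_sort_fset /= andbT.
apply/andP; split; last by case: b; rewrite ?allrel1l ?allrel0l //= andbT.
apply/allrelP => x y xS; rewrite mem_cat mem_nseq => /orP[/andP[_ /eqP ->]|yE].
  exact: (allP bS).
exact: ltn_trans (allP bS _ xS) (allP bE _ yE).
Qed.

(** For [b] true both sizes must be positive: otherwise [i] would be an endpoint of [0, i + m] and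
    not a proper partial sum. *)
Lemma beta_glue_set (b : bool) i m (S E : {fset nat}) :
  (0 < i + m)%N -> (b -> 0 < i /\ 0 < m)%N ->
  (S `<=` init_interval i.-1)%fset -> (E `<=` init_interval m.-1)%fset ->
  (if b then beta i S ++ beta m E else almost_cat (beta i S) (beta m E)) =
  beta (i + m) (glue_set b i S E).
Proof.
move=> im0 hb sS sE; rewrite [RHS]betaE // (sort_glue_set b sS sE).
have interval0 (T : {fset nat}) : (T `<=` init_interval 0)%fset -> T = fset0.
  by move=> sT; apply/fsetP => x; rewrite inE; apply/negP => /(sub_init_interval sT); lia.
(* A part of size 0 has the empty composition, which is neutral for [almost_cat]. *)
have [i0|i0] := posnP i.
  have b0 : b = false by case: b hb => // /(_ isT); lia.
  move: sS im0; rewrite i0 b0 => /interval0 ->; rewrite sort_fset0 => m0 /=.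
  by rewrite betaE // (eq_map (_ : addn 0 =1 id)) ?map_id.
have [m0|m0] := posnP m.
  have b0 : b = false by case: b hb => // /(_ isT); lia.
  move: sE; rewrite m0 b0 => /interval0 ->; rewrite sort_fset0 /= addn0 cats0.
  by rewrite betaE //; case: (pairmap _ _ _).
by rewrite !betaE //; apply: diffs_glue; exact: path_sort_rcons.
Qed.

(** By injectivity of [beta], the defining equation says that gluing [D1] to the complement of [D2]
    gives [D]. Elements below [i] then give [D1], those above [i] give [D2], and [i] itself agrees
    by the choice of gluing. *)
Lemma determinedP n (D : {fset nat}) i (D1 D2 : {fset nat}) :
  (0 < n)%N -> (D `<=` init_interval n.-1)%fset -> (i <= n)%N ->
  determined n D i D1 D2 <->
  D1 = [fset d in D | (d < i)%N]%fset /\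
  D2 = [fset d in init_interval (n - i).-1 | (i + d)%N \notin D]%fset.
Proof.
move=> n0 sD le_in; have [m def_n] : exists m, n = (i + m)%N.
  by exists (n - i)%N; rewrite subnKC.
have -> : (n - i)%N = m by rewrite def_n addKn.
have hb : (i \in D -> 0 < i /\ 0 < m)%N.
  by move=> /(sub_init_interval sD); lia.
have glueP (S T : {fset nat}) : (S `<=` init_interval i.-1)%fset ->
    (T `<=` init_interval m.-1)%fset -> determined n D i S T <->
    glue_set (i \in D) i S (init_interval m.-1 `\` T)%fset = D.
  move=> sS sT; have sC : (init_interval m.-1 `\` T `<=` init_interval m.-1)%fset.
    exact: fsubsetDl.
  rewrite /determined; have -> : (n - i)%N = m by rewrite def_n addKn.
  rewrite (beta_glue_set (b := i \in D)) -?def_n //.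
  split=> [[_ _]|->] //; apply: beta_inj => //.
  (* Injectivity of [beta] requires the glued set to lie in [n-1]. *)
  apply/fsubsetP => x; rewrite (in_glue_set _ _ sS sC) in_init_interval.
  case/or3P => [/andP[_ /(sub_init_interval sS)]|/andP[/hb h /eqP ->]|]; try lia.
  by case/andP => _ /(sub_init_interval sC); lia.
split=> [det|[-> ->]].
  have [sS sT _] := det; rewrite def_n addKn in sT.
  have sC := fsubsetDl (init_interval m.-1) D2.
  move/(glueP _ _ sS sT)/fsetP: det => det.
  split; apply/fsetP => x.
    rewrite !inE /= -det (in_glue_set _ _ sS sC).
    case: (ltngtP x i) => [xi|xi|->]; rewrite ?andbF ?andbT ?orbF //=.
      by apply/negP => /(sub_init_interval sS); lia.
    by apply/negP => /(sub_init_interval sS); lia.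
  (* Complementing twice within [m-1] returns [D2] because [D2] lies there. *)
  have xI : x \in D2 -> (0 < x <= m.-1)%N by move/(sub_init_interval sT).
  rewrite !inE -det (in_glue_set _ _ sS sC) addKn in_fsetD in_init_interval.
  rewrite mem_iota add1n ltnS; case: (x \in D2) xI => [/(_ isT)|_]; lia.
set S := [fset d in D | _]%fset; set T := [fset d in _ | _]%fset.
have inS x : (x \in S) = (x \in D) && (x < i)%N by rewrite !inE.
have inT x : (x \in T) = (0 < x <= m.-1)%N && ((i + x)%N \notin D).
  by rewrite -in_init_interval !inE.
have sS : (S `<=` init_interval i.-1)%fset.
  apply/fsubsetP => x; rewrite inS in_init_interval.
  by case/andP => /(sub_init_interval sD); lia.
have sT : (T `<=` init_interval m.-1)%fset.
  by apply/fsubsetP => x; rewrite inT in_init_interval => /andP[].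
apply/(glueP _ _ sS sT)/fsetP => x.
rewrite (in_glue_set _ _ sS (fsubsetDl (init_interval m.-1) T)).
rewrite in_fsetD in_init_interval inS inT.
have [xi|xi|->] := ltngtP x i; rewrite ?andbF ?andbT ?orbF //=.
rewrite subnKC ?(ltnW xi) //.
by have [/(sub_init_interval sD)|_] := boolP (x \in D); lia.
Qed.

(** * Splitting words into a part over A and a part over A' *)

Section WordSplitting.

Variables k l : nat.

Lemma superQ_seq_mono n D (a : {ffun 'I_n -> 'I_(k + l)}) :
  superQ_seq D a -> forall s t : 'I_n, (s <= t)%N -> (a s <= a t)%N.
Proof.
move=> /'forall_forallP sa s [t lt_tn] /= le_st.
elim: t lt_tn le_st => [|t IHt] lt_tn le_st.
  by rewrite (_ : s = Ordinal lt_tn) //; apply: val_inj => /=; lia.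
move: le_st; rewrite leq_eqVlt => /orP[/eqP e|lt_st].
  by rewrite (_ : s = Ordinal lt_tn) //; apply: val_inj.
apply: leq_trans (IHt (ltnW lt_tn) lt_st) _.
by have /implyP/(_ (eqxx _))/and3P[] := sa (Ordinal (ltnW lt_tn)) (Ordinal lt_tn).
Qed.

Definition splits_at n i (a : {ffun 'I_n -> 'I_(k + l)}) : bool :=
  [forall t : 'I_n, (a t < k)%N == (t < i)%N].

Lemma splits_at_ex n D (a : {ffun 'I_n -> 'I_(k + l)}) :
  superQ_seq D a -> exists i : 'I_n.+1, splits_at i a.
Proof.
move=> /superQ_seq_mono a_mono.
(* The splitting point is the least position from which all letters lie in A'; [n] qualifies
   vacuously. *)
pose P j := [forall t : 'I_n, (j <= t)%N ==> (k <= a t)%N].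
have Pn : P n by apply/forallP => t; rewrite leqNgt ltn_ord.
case: (ex_minnP (ex_intro P n Pn)) => i /forallP Pi i_min.
exists (Ordinal (i_min n Pn : i < n.+1)%N); apply/forallP => t /=; apply/eqP.
have [lt_ti|le_it] := ltnP t i; last first.
  by apply/negbTE; rewrite -leqNgt; apply: (implyP (Pi t)).
(* A letter of A' before [i] would, by monotonicity, contradict the minimality of [i]. *)
apply: contraTT lt_ti; rewrite -!leqNgt => le_kt; apply: i_min.
by apply/forallP => s; apply/implyP => /a_mono; apply: leq_trans.
Qed.

Lemma splits_at_inj n (a : {ffun 'I_n -> 'I_(k + l)}) (i j : 'I_n.+1) :
  splits_at i a -> splits_at j a -> i = j.
Proof.
move=> /forallP ai /forallP aj; apply: val_inj => /=.
have agree t : (t < n)%N -> (t < i)%N = (t < j)%N.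
  by move=> lt_tn; rewrite -(eqP (ai (Ordinal lt_tn))) -(eqP (aj (Ordinal lt_tn))).
(* If [i < j] then [i < n], and [agree] at [i] equates [i < i] with [i < j]; the other case is
   symmetric. *)
have [] := (agree i, agree j).
by have := (ltn_ord i, ltn_ord j); case; lia.
Qed.

Definition cat_word i m (p : {ffun 'I_i -> 'I_k} * {ffun 'I_m -> 'I_l}) :
    {ffun 'I_(i + m) -> 'I_(k + l)} :=
  [ffun t => match split t with
             | inl u => lshift l (p.1 u)
             | inr v => rshift k (p.2 v)
             end].

Lemma cat_word_lshift i m (p : {ffun 'I_i -> 'I_k} * {ffun 'I_m -> 'I_l}) u :
  cat_word p (lshift m u) = lshift l (p.1 u).
Proof. by rewrite ffunE -[lshift m u]/(unsplit (inl u)) unsplitK. Qed.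

Lemma cat_word_rshift i m (p : {ffun 'I_i -> 'I_k} * {ffun 'I_m -> 'I_l}) v :
  cat_word p (rshift i v) = rshift k (p.2 v).
Proof. by rewrite ffunE -[rshift i v]/(unsplit (inr v)) unsplitK. Qed.

Lemma cat_word_inj i m : injective (@cat_word i m).
Proof.
move=> [b c] [b' c'] /ffunP e; congr (_, _); apply/ffunP => u.
  by have := e (lshift m u); rewrite !cat_word_lshift; apply: lshift_inj.
by have := e (rshift i u); rewrite !cat_word_rshift; apply: rshift_inj.
Qed.

Lemma splits_at_cat_word i m (a : {ffun 'I_(i + m) -> 'I_(k + l)}) :
  splits_at i a = (a \in codom (@cat_word i m)).
Proof.
apply/forallP/codomP => [sa|[p ->] t]; last first.
  apply/eqP; case: (split_ordP t) => u ->; rewrite ?cat_word_lshift ?cat_word_rshift /=.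
    by rewrite !ltn_ord.
  lia.
have lt_ak u : (a (lshift m u) < k)%N by rewrite (eqP (sa _)) /= ltn_ord.
have le_ka v : (k <= a (rshift i v))%N.
  by rewrite leqNgt (eqP (sa _)) /= ltnNge leq_addr.
have lt_al v : (a (rshift i v) - k < l)%N.
  by rewrite ltn_subLR //; apply: le_ka.
exists ([ffun u => Ordinal (lt_ak u)], [ffun v => Ordinal (lt_al v)]).
apply/ffunP => t; apply: val_inj.
by case: (split_ordP t) => u ->;
  rewrite ?cat_word_lshift ?cat_word_rshift /= ffunE //= subnKC.
Qed.

(** Equal neighbours in the primed part at offset [x] require [i + x] to be in [D], that is [x] not
    in [D2]: the rule for [F_seq]. Only interior positions of each part are tested, hence the ranges
    in the hypotheses. *)
Lemma superQ_seq_cat_word i m (D D1 D2 : {fset nat})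
    (p : {ffun 'I_i -> 'I_k} * {ffun 'I_m -> 'I_l}) :
  (forall x, (0 < x < i)%N -> (x \in D1) = (x \in D)) ->
  (forall x, (0 < x < m)%N -> (x \in D2) = ((i + x)%N \notin D)) ->
  superQ_seq D (cat_word p) = F_seq D1 p.1 && F_seq D2 p.2.
Proof.
move=> eD1 eD2.
apply/'forall_forallP/andP => [sp|[/'forall_forallP s1 /'forall_forallP s2] s t].
  split; apply/'forall_forallP => s t; apply/implyP => /eqP e.
    have := sp (lshift m s) (lshift m t).
    rewrite !cat_word_lshift /= e eqxx /= (inj_eq (@lshift_inj _ _)) ltn_ord andbT.
    by case/and3P => -> + _ /=; rewrite eD1 // -e ltn_ord andbT e.
  have := sp (rshift i s) (rshift i t).
  rewrite !cat_word_rshift /= e addnS eqxx /= leq_add2l.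
  rewrite (inj_eq (@rshift_inj _ _)) leq_addr andbT.
  case/and3P => -> _ /=; rewrite eD2 ?addnS ?negbK //.
  by rewrite -e ltn_ord andbT e.
apply/implyP => /eqP e.
case: (split_ordP s) e => u ->; case: (split_ordP t) => v -> /= e.
- have := s1 u v; rewrite e eqxx => /andP[le_uv].
  rewrite !cat_word_lshift (inj_eq (@lshift_inj _ _)) /= le_uv ltn_ord andbT.
  by rewrite eD1 ?[(k <= _)%N]leqNgt ?ltn_ord ?andbF ?andbT //= -e.
(* At the junction the letters lie in A and A', so they increase strictly and [D] is not
   consulted. *)
- rewrite cat_word_lshift cat_word_rshift eq_lrshift /= andbT.
  by have := ltn_ord (p.1 u); lia.
- by have := ltn_ord v; lia.
have e' : v = u.+1 :> nat by lia.
have := s2 u v; rewrite e' eqxx => /andP[le_uv].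
rewrite !cat_word_rshift (inj_eq (@rshift_inj _ _)) /= leq_add2l le_uv.
rewrite ltnNge leq_addr andbF andbT /= eD2 ?addnS ?negbK // -e'.
by have := ltn_ord v; lia.
Qed.

(** * From words to generating functions *)

Lemma zvar_lshift (R : comNzRingType) (x : 'I_k -> R) (y : 'I_l -> R) u :
  zvar x y (lshift l u) = x u.
Proof. by rewrite /zvar -[lshift l u]/(unsplit (inl u)) unsplitK. Qed.

Lemma zvar_rshift (R : comNzRingType) (x : 'I_k -> R) (y : 'I_l -> R) v :
  zvar x y (rshift k v) = y v.
Proof. by rewrite /zvar -[rshift k v]/(unsplit (inr v)) unsplitK. Qed.

Lemma sum_splits_at (R : comNzRingType) n i (D D1 D2 : {fset nat})
    (x : 'I_k -> R) (y : 'I_l -> R) : (i <= n)%N ->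
  (forall d, (0 < d < i)%N -> (d \in D1) = (d \in D)) ->
  (forall d, (0 < d < n - i)%N -> (d \in D2) = ((i + d)%N \notin D)) ->
  \sum_(a : {ffun 'I_n -> 'I_(k + l)} | superQ_seq D a && splits_at i a)
     \prod_(t < n) zvar x y (a t) = fundQ i D1 x * fundQ (n - i) D2 y.
Proof.
(* Writing [n] as [i + m] gives the words the type of the values of [cat_word], along which the sum
   over pairs is reindexed. *)
move=> /subnKC; move: (n - i)%N => m <- {n} eD1 eD2.
rewrite /fundQ big_distrlr pair_big /=.
pose A := [set p : {ffun 'I_i -> 'I_k} * {ffun 'I_m -> 'I_l} |
           F_seq D1 p.1 && F_seq D2 p.2].
transitivity (\sum_(a in @cat_word i m @: A) \prod_(t < i + m) zvar x y (a t)).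
  apply: eq_bigl => a; rewrite splits_at_cat_word.
  apply/andP/imsetP => [[sa /codomP[p e]]|[p]].
    by exists p => //; rewrite inE -(superQ_seq_cat_word _ eD1 eD2) -e.
  by rewrite inE -(superQ_seq_cat_word _ eD1 eD2) => sp ->; rewrite codom_f.
rewrite big_imset => [|p q _ _]; last exact: cat_word_inj.
apply: eq_big => [p|p _]; first by rewrite inE.
rewrite big_split_ord /=; congr (_ * _); apply: eq_bigr => u _.
  by rewrite cat_word_lshift zvar_lshift.
by rewrite cat_word_rshift zvar_rshift.
Qed.

Lemma superQ_split (R : comNzRingType) n (D : {fset nat}) (D1 D2 : nat -> {fset nat})
    (x : 'I_k -> R) (y : 'I_l -> R) :
  (forall i d, (i <= n)%N -> (0 < d < i)%N -> (d \in D1 i) = (d \in D)) ->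
  (forall i d, (i <= n)%N -> (0 < d < n - i)%N ->
     (d \in D2 i) = ((i + d)%N \notin D)) ->
  superQ n D x y = \sum_(i < n.+1) fundQ i (D1 i) x * fundQ (n - i) (D2 i) y.
Proof.
move=> eD1 eD2; pose len (a : {ffun 'I_n -> 'I_(k + l)}) :=
  (* The default [ord0] is never reached on words satisfying [superQ_seq], since these do split. *)
  odflt ord0 [pick i : 'I_n.+1 | splits_at i a].
rewrite /superQ (partition_big len xpredT) //=; apply: eq_bigr => i _.
have le_in : (i <= n)%N by rewrite -ltnS ltn_ord.
rewrite -(sum_splits_at _ _ le_in (eD1 i ^~ le_in) (eD2 i ^~ le_in)).
apply: eq_bigl => a; case sa: (superQ_seq D a) => //=.
rewrite /len; case: pickP => [j sj|no_split] /=; last first.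
  by have [j] := splits_at_ex sa; rewrite no_split.
apply/eqP/idP => [<- //|]; exact: splits_at_inj.
Qed.

End WordSplitting.

Theorem theorem4p1 (R : comNzRingType) (k l n : nat) (D : {fset nat})
    (hn : (1 <= n)%N) (hD : (D `<=` init_interval n.-1)%fset) :
  (forall i : nat, (i <= n)%N ->
     exists! P : {fset nat} * {fset nat}, determined n D i P.1 P.2) /\
  (forall D1 D2 : nat -> {fset nat},
     (forall i : nat, (i <= n)%N -> determined n D i (D1 i) (D2 i)) ->
     superQ n D (@Xvar R k l) (@Yvar R k l) =
     \sum_(i < n.+1)
        fundQ i (D1 i) (@Xvar R k l) * fundQ (n - i) (D2 i) (@Yvar R k l)).
Proof.
split=> [i le_in|D1 D2 det].
  (* The explicit pair computed in [determinedP]. *)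
  exists ([fset d in D | (d < i)%N],
          [fset d in init_interval (n - i).-1 | (i + d)%N \notin D])%fset.
  split=> [|[S T] /(determinedP _ _ hn hD le_in) /= [-> ->] //].
  exact/(determinedP _ _ hn hD le_in).
apply: superQ_split => i d le_in lt_d;
  have /(determinedP _ _ hn hD le_in) [eD1 eD2] := det i le_in.
  by rewrite eD1 !inE; case/andP: lt_d => _ ->; rewrite andbT.
rewrite eD2 !inE mem_iota; case: (_ \notin D); rewrite ?andbF //= andbT.
by move: lt_d; lia.
Qed.
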